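(* Let $\Gamma = \langle v_0, v_1\rangle$ be a numerical semigroup with minimal generators $v_0 < v_1$. Then $\mathcal{R}_\Gamma \leftrightarrow \mathbb{C}^{M(\Gamma)}$ (that is, $\mathcal{R}_\Gamma$ is in bijection with $\mathbb{C}^{M(\Gamma)}$ via the coefficients of normal-form generators), where $$M(\Gamma) = \#\{\text{gaps of } \Gamma \text{ greater than } v_0\} + \#\{\text{gaps of } \Gamma \text{ greater than } v_1\}.$$
   Context: $\mathbb{N}$ contains $0$. A numerical semigroup $\Gamma \subseteq \mathbb{N}$ is a subset containing $0$, closed under addition, and containing all sufficiently large integers; its conductor $c$ is the element with $c-1 \notin \Gamma$ and $n \in \Gamma$ for all $n \geq c$. A gap of $\Gamma$ is an element of $\mathbb{N}\setminus\Gamma$. $\mathcal{R}_\Gamma$ is the set of complete $\mathbb{C}$-subalgebras of $\mathbb{C}[[t]]$ with semigroup (set of orders of nonzero elements) equal to $\Gamma$. Since every such subalgebra contains the ideal $(t^c)$, $\mathcal{R}_\Gamma$ is identified with the set of $\mathbb{C}$-subalgebras $R$ of $\mathbb{C}[t]/(t^c)$ with $\Gamma_R = \Gamma$, where $\Gamma_R = \{n \mid \exists f \in R\setminus\{0\},\ \operatorname{ord} f = n\} \cup \{n \in \mathbb{N} \mid n \geq c\}$. Meaning of $\leftrightarrow$: a pair $\{x_0(t),x_1(t)\}$ in $\mathbb{C}[t]/(t^c)$ is in normal form with respect to $\Gamma$ if $x_i(t) = t^{v_i} + \sum_\delta a_{i,\delta}t^\delta$ for $i=0,1$, the sum running over gaps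 $\delta > v_i$ of $\Gamma$ (with $x_i(t)=0$ in $\mathbb{C}[t]/(t^c)$ if $v_i \geq c$). Such pairs are identified with the points $(a_{i,\delta})$ of $\mathbb{C}^{M(\Gamma)}$, and a point of $\mathbb{C}^{M(\Gamma)}$ corresponds to the ring $\mathbb{C}[x_0(t),x_1(t)] \subseteq \mathbb{C}[t]/(t^c)$. *)

(* Defs.v *)
From mathcomp Require Import all_boot all_order all_algebra.
From mathcomp Require Import boolp classical_sets functions reals.
From mathcomp Require Export complex.

Set Implicit Arguments.
Unset Strict Implicit.
Unset Printing Implicit Defensive.

Import Order.TTheory GRing.Theory Num.Theory.

Local Open Scope classical_set_scope.
Local Open Scope ring_scope.

Definition submonoid (M : set nat) : Prop :=
  M 0%N /\ forall m n : nat, M m -> M n -> M (m + n)%N.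

Definition numerical_semigroup (G : set nat) : Prop :=
  submonoid G /\ exists N : nat, forall n : nat, (N <= n)%N -> G n.

(* The second clause says that c - 1 is not in G; when c = 0 this integer is
   negative and there is nothing to check. *)
Definition is_conductor (G : set nat) (c : nat) : Prop :=
  (forall n : nat, (c <= n)%N -> G n) /\ (forall m : nat, c = m.+1 -> ~ G m).

Definition minimal_generators (G S : set nat) : Prop :=
  smallest submonoid S = G /\
  forall T : set nat, T `<=` S -> smallest submonoid T = G -> T = S.

(* K[t]/(t^c) for c > 0 only: the library replaces a constant modulus by 'X.
   A numerical semigroup with two minimal generators has conductor at least 2. *)
Notation trunc K c := {poly %/ ('X^c : {poly K})}.

Section TruncatedPolynomials.
Variables (K : fieldType) (c : nat).

(* Meaningful for f != 0 only. *)
Definition trunc_ord (f : trunc K c) : nat :=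
  find (fun a : K => a != 0) (polyseq (val f)).

Definition subalgebra (A : set (trunc K c)) : Prop := GRing.subalg_closed [in A].

Definition semigroup_of (A : set (trunc K c)) : set nat :=
  [set n | exists f : trunc K c, [/\ A f, f != 0 & trunc_ord f = n]]
    `|` [set n | (c <= n)%N].

Definition rings_with_semigroup (G : set nat) : set (set (trunc K c)) :=
  [set A | subalgebra A /\ semigroup_of A = G].

End TruncatedPolynomials.

(* When c is the conductor of G, every gap of G is smaller than c. *)
Definition gaps_above (G : set nat) (c v : nat) : pred 'I_c :=
  [pred d : 'I_c | (v < d)%N && (nat_of_ord d \notin G)].
Arguments gaps_above : clear implicits.

(* t^v plus a combination of the t^d, for d a gap above v; the coordinates of
   the coefficient vector a follow the increasing enumeration of these gaps. *)
Definition normal_form (K : fieldType) (G : set nat) (c v : nat)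
    (a : 'rV[K]_#|gaps_above G c v|) : trunc K c :=
  in_qpoly 'X^c
    ('X^v + \sum_(k < #|gaps_above G c v|)
              a ord0 k *: 'X^(nat_of_ord (enum_val k))).

Definition num_params (G : set nat) (c v0 v1 : nat) : nat :=
  (#|gaps_above G c v0| + #|gaps_above G c v1|)%N.

Definition ring_of_point (K : fieldType) (G : set nat) (c v0 v1 : nat)
    (a : 'rV[K]_(num_params G c v0 v1)) : set (trunc K c) :=
  smallest (@subalgebra K c)
    [set normal_form (lsubmx a); normal_form (rsubmx a)].

(* Main.v *)
Require Import Defs.
From mathcomp Require Import all_boot all_order all_algebra.
From mathcomp Require Import boolp classical_sets functions reals complex.
From mathcomp Require Import zify.

Set Implicit Arguments.
Unset Strict Implicit.
Unset Printing Implicit Defensive.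

Import Order.TTheory GRing.Theory Num.Theory.

Local Open Scope classical_set_scope.
Local Open Scope ring_scope.

(** Why the theorem holds.  Write [G] for the semigroup generated by [v0] and
    [v1], which are coprime because [G] is cofinite.

    The point that makes two generators special is that a number below the
    conductor is [i * v0 + j * v1] in at most one way ([gen2_unique]): two
    representations force the number to be at least [v0 * v1], and everything
    from there on lies in [G] ([gen2_ge_mul]).  So if [x] and [y] start with
    [t^v0] and [t^v1], no matter what follows, the nonzero monomials
    [x^i * y^j] in [K[t]/(t^c)] have pairwise distinct orders, all in [G].  No
    cancellation of leading terms is possible, and the order of a linear
    combination of them is again one of these orders
    ([order_of_combination]).  Hence [K[x, y]] always has semigroup [G]
    ([semigroup_of_gen2]): the parameters are unconstrained.

    The correspondence is then the usual reduction modulo leading terms.  Let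
    [A] be a subalgebra with semigroup [G].  For [v] in [G] it contains an
    element starting with [t^v], and subtracting multiples of elements of order
    [n] for the [n > v] in [G] puts it in normal form ([normal_form_exists]).
    That form is unique in [A], as a difference of two normal forms involves
    only gaps and so cannot have an order in [G] ([normal_form_inj]); this
    makes the map injective.  The two normal forms found in [A] generate a
    subalgebra of [A] with the same semigroup, which is all of [A]
    ([subalgebra_eq_of_semigroup]); this makes it surjective. *)

(** * Semigroups with two generators *)

Lemma smallest_submonoid (S : set nat) : submonoid (smallest submonoid S).
Proof.
split=> [A [[A0 _] _] //|m n Sm Sn A [AM SA]].
by apply: AM.2; [exact: Sm | exact: Sn].
Qed.

Lemma gen2P (v0 v1 n : nat) :
  smallest submonoid [set v0; v1] n <->
  exists i j : nat, n = (i * v0 + j * v1)%N.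
Proof.
have [G0 GD] := smallest_submonoid [set v0; v1].
have GM k v : smallest submonoid [set v0; v1] v ->
    smallest submonoid [set v0; v1] (k * v)%N.
  by move=> Gv; elim: k => [//|k IHk]; rewrite mulSn; exact: GD.
split=> [|[i [j ->]]].
  apply: (smallest_sub (X := [set m | exists i j, m = i * v0 + j * v1]%N)).
    split; first by exists 0%N, 0%N.
    by move=> _ _ [i [j ->]] [k [l ->]]; exists (i + k)%N, (j + l)%N; lia.
  move=> _ [-> | ->].
  - by exists 1%N, 0%N; lia.
  - by exists 0%N, 1%N; lia.
by apply: GD; apply: GM; apply: sub_gen_smallest; [left | right].
Qed.

(** The gcd divides every element of the semigroup, hence two consecutive
    integers. *)
Lemma gen2_coprime (v0 v1 : nat) :
  numerical_semigroup (smallest submonoid [set v0; v1]) -> coprime v0 v1.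
Proof.
move=> [_ [N GN]]; rewrite /coprime -dvdn1.
have dvdG n : smallest submonoid [set v0; v1] n -> (gcdn v0 v1 %| n)%N.
  move/gen2P=> [i [j ->]].
  by rewrite dvdn_add // dvdn_mull // ?dvdn_gcdl ?dvdn_gcdr.
have dN := dvdG _ (GN N (leqnn N)).
by have := dvdG _ (GN N.+1 (leqnSn N)); rewrite -addn1 dvdn_addr.
Qed.

(** This excludes the degenerate generators: [1] can only come from one of the
    two, and then it generates everything alone, against minimality.  It is the
    source of [0 < c] and [0 < v0] in the main argument. *)
Lemma gen2_not1 (G : set nat) (v0 v1 : nat) :
  (v0 < v1)%N -> minimal_generators G [set v0; v1] -> ~ G 1%N.
Proof.
move=> lt01 [GE minS] G1.
have S1 : [set v0; v1] 1%N.
  move: G1; rewrite -GE => /gen2P [i [j e]].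
  have [i0|i1] : (i * v0 = 0 /\ j * v1 = 1 \/ i * v0 = 1 /\ j * v1 = 0)%N by lia.
    by right => /=; have /eqP := i0.2; rewrite muln_eq1 => /andP[_ /eqP].
  by left => /=; have /eqP := i1.1; rewrite muln_eq1 => /andP[_ /eqP].
have Gall (M : set nat) : submonoid M -> M 1%N -> forall n, M n.
  by move=> [M0 MD] M1; elim=> [//|n Mn]; rewrite -addn1; exact: MD.
have S_sub : [set 1%N] `<=` [set v0; v1] by move=> _ ->.
have /(minS _ S_sub) e : smallest submonoid [set 1%N] = G.
  apply/seteqP; split=> n _; last first.
    apply: Gall; first exact: smallest_submonoid.
    exact: sub_gen_smallest.
  by rewrite -GE; apply: (Gall _ (smallest_submonoid _)); rewrite GE.
have [] : [set 1%N] v0 /\ [set 1%N] v1 by rewrite e; split; [left | right].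
by move=> /= e0 e1; lia.
Qed.

(** Modulo [v0] every [n] is some [j * v1] with [j < v0]; when [n] is at least
    [v0 * v1] the difference [n - j * v1] is a nonnegative multiple of [v0]. *)
Lemma gen2_ge_mul (v0 v1 n : nat) :
  (0 < v0)%N -> coprime v0 v1 -> (v0 * v1 <= n)%N ->
  smallest submonoid [set v0; v1] n.
Proof.
move=> v0_gt0 cop le_n; apply/gen2P.
pose j := ((chinese v0 v1 n 0 %/ v1) %% v0)%N.
have v1_dvd : (v1 %| chinese v0 v1 n 0)%N.
  by rewrite /dvdn (chinese_modr cop) mod0n.
have ej : (j * v1 = n %[mod v0])%N.
  by rewrite modnMml divnK // (chinese_modl cop).
have lt_j : (j < v0)%N by rewrite ltn_pmod.
have le_jn : (j * v1 <= n)%N by apply: leq_trans le_n; rewrite leq_mul2r (ltnW lt_j) orbT.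
have : (v0 %| n - j * v1)%N by rewrite -eqn_mod_dvd // ej.
by move=> /dvdnP [i e]; exists i, j; lia.
Qed.

Lemma conductor_le_mul (v0 v1 c : nat) :
  (0 < v0)%N -> coprime v0 v1 ->
  is_conductor (smallest submonoid [set v0; v1]) c -> (c <= v0 * v1)%N.
Proof.
case: c => [//|m] v0_gt0 cop [_ /(_ m erefl) Gm]; rewrite ltnNge.
by apply/negP => /(gen2_ge_mul v0_gt0 cop).
Qed.

(** If [j < l], coprimality makes [v0] divide [l - j], so that [l >= v0] and
    the common value is at least [v0 * v1]. *)
Lemma gen2_unique (v0 v1 i j k l : nat) :
  (0 < v0)%N -> coprime v0 v1 ->
  (i * v0 + j * v1 = k * v0 + l * v1)%N -> (i * v0 + j * v1 < v0 * v1)%N ->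
  i = k /\ j = l.
Proof.
move=> v0_gt0 cop.
wlog le_jl : i j k l / (j <= l)%N => [wl e lt|e lt].
  have [/wl|/ltnW le_lj] := leqP j l; first exact.
  by move: lt; rewrite e => lt; have [-> ->] := wl _ _ _ _ le_lj (esym e) lt.
have v0_dvd : (v0 %| l - j)%N.
  rewrite -(Gauss_dvdl _ cop); apply/dvdnP; exists (i - k)%N; nia.
have lj : (l - j = 0)%N.
  case: (posnP (l - j)) => // /dvdn_leq /(_ v0_dvd) le_v0; nia.
have jl : j = l by lia.
split=> //; move: e; rewrite jl => /addIn /eqP.
by rewrite eqn_pmul2r // => /eqP.
Qed.

(** * Coefficients and orders of truncated polynomials *)

Section Truncated.
Variables (K : fieldType) (c : nat).
Hypothesis c_gt0 : (0 < c)%N.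
Implicit Types (f g : trunc K c) (A B : set (trunc K c)).

Definition tcoef f (m : nat) : K := (polyn f)`_m.

Lemma tcoef_in_qpoly (p : {poly K}) m :
  (m < c)%N -> tcoef (in_qpoly 'X^c p) m = p`_m.
Proof.
move=> lt_mc; rewrite /tcoef /= mk_monic_Xn prednK //.
by rewrite -Pdiv.RingMonic.take_poly_rmodp coef_take_poly lt_mc.
Qed.

Lemma tcoef_default f m : (c <= m)%N -> tcoef f m = 0.
Proof.
move=> le_cm; rewrite /tcoef nth_default //; apply: leq_trans le_cm.
(* The modulus occurs in the type of [f], so it is rewritten away from [f]. *)
move: (size _) (size_mk_monic f) => s.
by rewrite mk_monic_Xn prednK // size_polyXn ltnS.
Qed.

Lemma tcoefP f g : (forall m, (m < c)%N -> tcoef f m = tcoef g m) -> f = g.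
Proof.
move=> efg; apply/npolyP => m.
by have [/efg // | le_cm] := ltnP m c; rewrite -!/(tcoef _ _) !tcoef_default.
Qed.

Lemma tcoef0 m : tcoef 0 m = 0.
Proof. by rewrite /tcoef coef0. Qed.

Lemma tcoef1 m : tcoef 1 m = (m == 0%N)%:R.
Proof. by rewrite /tcoef coef1. Qed.

Lemma tcoefD f g m : tcoef (f + g) m = tcoef f m + tcoef g m.
Proof. by rewrite /tcoef coefD. Qed.

Lemma tcoefZ (a : K) f m : tcoef (a *: f) m = a * tcoef f m.
Proof. by rewrite /tcoef coefZ. Qed.

Lemma tcoef_sum (I : finType) (F : I -> trunc K c) m :
  tcoef (\sum_i F i) m = \sum_i tcoef (F i) m.
Proof. by rewrite /tcoef poly_of_qpoly_sum coef_sum. Qed.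

Lemma tcoefM f g m : (m < c)%N ->
  tcoef (f * g) m = \sum_(i < m.+1) tcoef f i * tcoef g (m - i).
Proof. by move=> lt_mc; rewrite tcoef_in_qpoly // coefM. Qed.

(** Replaces the order by a condition on coefficients, the form in which it is
    used everywhere below. *)
Lemma trunc_ordP f n : f != 0 /\ trunc_ord f = n <->
  tcoef f n != 0 /\ forall m, (m < n)%N -> tcoef f m = 0.
Proof.
rewrite /trunc_ord /tcoef; set s := polyseq _; set nz := fun _ => _; split.
  move=> [f_neq0 <-]; split=> [|m /(before_find 0)/negbFE/eqP //].
  have p_neq0 : polyn f != 0 by apply: contraNneq f_neq0 => e; exact/eqP/val_inj.
  suff /(nth_find 0) : has nz s by [].
  apply/(has_nthP 0); exists (size s).-1.
    by rewrite prednK // size_poly_gt0.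
  by rewrite /nz -[s`_ _]/(lead_coef _) lead_coef_eq0.
move=> [sn_neq0 sm0]; split.
  by apply: contraNneq sn_neq0 => e; rewrite /s e coef0.
have nz_s : has nz s.
  apply/(has_nthP 0); exists n => //; rewrite ltnNge.
  by apply: contra sn_neq0 => /(nth_default 0) ->.
case: (ltngtP (find nz s) n) => // [/sm0 e|/(before_find 0)].
  by have := nth_find 0 nz_s; rewrite /nz e eqxx.
by rewrite /nz sn_neq0.
Qed.

(** The element starts with [t^u]; for [u >= c] this says that it is zero, in
    accordance with [t^u = 0].  Treating both cases at once lets products and
    generators be handled without comparing exponents with [c]. *)
Definition unitary_at (u : nat) f : Prop :=
  forall m, (m <= u)%N -> (m < c)%N -> tcoef f m = (m == u)%:R.

Lemma unitary_at0 u : (c <= u)%N -> unitary_at u 0.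
Proof. by move=> le_cu m _ lt_mc; rewrite tcoef0 ltn_eqF //; lia. Qed.

Lemma unitary_at1 : unitary_at 0 1.
Proof. by move=> m _ _; rewrite tcoef1. Qed.

Lemma unitary_atM u v f g :
  unitary_at u f -> unitary_at v g -> unitary_at (u + v) (f * g).
Proof.
move=> fu gv m le_m lt_mc; rewrite tcoefM //.
have E (i : 'I_m.+1) :
    tcoef f i * tcoef g (m - i) = ((i == u :> nat) && (m - i == v)%N)%:R.
  have := ltn_ord i => lt_i.
  have [le_iu|lt_ui] := leqP i u; last first.
    rewrite gtn_eqF //= gv; [|lia|lia].
    by rewrite ltn_eqF ?mulr0 //; lia.
  have [le_v|lt_v] := leqP (m - i) v.
    by rewrite fu ?gv -?natrM ?mulnb //; lia.
  rewrite fu; [|lia|lia].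
  by rewrite ltn_eqF ?mul0r //; lia.
rewrite (eq_bigr _ (fun i _ => E i)); have [->|ne_m] := eqVneq m (u + v)%N.
  have lt_u : (u < (u + v).+1)%N by lia.
  rewrite (bigD1 (Ordinal lt_u)) //= big1 ?addKn ?eqxx ?addr0 // => i.
  by rewrite -val_eqE /= => /negPf ->.
rewrite big1 // => i _; case: andP => // -[/eqP e1 /eqP e2].
by have := ltn_ord i; move: ne_m => /eqP; lia.
Qed.

Lemma unitary_atX u f n : unitary_at u f -> unitary_at (n * u) (f ^+ n).
Proof.
move=> fu; elim: n => [|n IHn]; first by rewrite expr0; exact: unitary_at1.
by rewrite exprS mulSn; exact: unitary_atM.
Qed.

(** Distinct weights below [c] prevent leading terms from cancelling: reading
    the vanishing coefficients of [f] in increasing degree shows successively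
    that each [a i] of weight below [n] is zero, and then only an element of
    weight [n] can contribute to the coefficient of degree [n]. *)
Lemma order_of_combination (I : finType) (w : I -> nat) (e : I -> trunc K c)
    (a : I -> K) f n :
  (forall i, unitary_at (w i) (e i)) ->
  (forall i k, (w i < c)%N -> w i = w k -> i = k) ->
  f = \sum_i a i *: e i ->
  (n < c)%N -> tcoef f n != 0 -> (forall m, (m < n)%N -> tcoef f m = 0) ->
  exists i, w i = n.
Proof.
move=> ew w_inj f_def lt_nc fn_neq0 f_lt_n.
have tcoef_f m : tcoef f m = \sum_i a i * tcoef (e i) m.
  by rewrite f_def tcoef_sum; apply: eq_bigr => i _; rewrite tcoefZ.
have a0 : forall m, (m <= n)%N -> forall i, (w i < m)%N -> a i = 0.
  elim=> [//|m IHm] lt_mn i; rewrite ltnS leq_eqVlt => /orP[/eqP wi|]; last first.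
    by apply: IHm; exact: ltnW.
  (* Other terms vanish in degree m: lower weights by induction, higher ones
     by their order, and equal weight is excluded by injectivity. *)
  have := f_lt_n m lt_mn; rewrite tcoef_f (bigD1 i) //= big1 => [|k ne_ki].
    by rewrite ew ?wi ?eqxx ?mulr1 ?addr0 //; lia.
  have [lt_km|le_mk] := ltnP (w k) m; first by rewrite (IHm (ltnW lt_mn)) ?mul0r.
  rewrite ew //; last by lia.
  have [e_mk|_] := eqVneq m (w k); last by rewrite mulr0.
  by move: ne_ki; rewrite -(w_inj i k) ?eqxx //; lia.
apply: contrapT => nw; move/eqP: fn_neq0; apply; rewrite tcoef_f big1 // => i _.
have [lt_in|le_ni] := ltnP (w i) n; first by rewrite (a0 n) ?mul0r.
rewrite ew //; have [e_n|_] := eqVneq n (w i); last by rewrite mulr0.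
by case: nw; exists i.
Qed.

(** * Subalgebras and their semigroups *)

Lemma subalgebraP A : subalgebra A <->
  [/\ A 1, forall (a : K) f g, A f -> A g -> A (a *: f + g)
     & forall f g, A f -> A g -> A (f * g)].
Proof.
split=> [[A1 AD AM]|[A1 AD AM]]; split.
- by move: A1; rewrite inE.
- by move=> a f g Af Ag; move: (AD a f g); rewrite !inE; exact.
- by move=> f g Af Ag; move: (AM f g); rewrite !inE; exact.
- by rewrite inE.
- by move=> a f g; rewrite !inE; exact: AD.
- by move=> f g; rewrite !inE; exact: AM.
Qed.

Lemma subalgebraB A f g : subalgebra A -> A f -> A g -> A (f - g).
Proof.
by case/subalgebraP => _ AD _ Af Ag; rewrite addrC -scaleN1r; exact: AD.
Qed.

Lemma subalgebra0 A : subalgebra A -> A 0.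
Proof.
move=> Aalg; have [A1 _ _] := (subalgebraP A).1 Aalg.
by rewrite -(subrr 1); exact: subalgebraB.
Qed.

Lemma subalgebraX A f n : subalgebra A -> A f -> A (f ^+ n).
Proof.
case/subalgebraP => A1 _ AM Af; elim: n => [|n IHn]; first by rewrite expr0.
by rewrite exprS; exact: AM.
Qed.

Lemma smallest_subalgebra (S : set (trunc K c)) :
  subalgebra (smallest (@subalgebra K c) S).
Proof.
apply/subalgebraP; split=> [A [/subalgebraP[A1 _ _] _] //|a f g Sf Sg A AS|].
  have [/subalgebraP[_ AD _] _] := AS.
  by apply: AD; [exact: Sf | exact: Sg].
move=> f g Sf Sg A AS; have [/subalgebraP[_ _ AM] _] := AS.
by apply: AM; [exact: Sf | exact: Sg].
Qed.

Lemma semigroup_of_order A f n : A f -> tcoef f n != 0 ->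
  (forall m, (m < n)%N -> tcoef f m = 0) -> semigroup_of A n.
Proof.
move=> Af fn_neq0 f_lt_n; left; exists f.
by have /trunc_ordP[f_neq0 fn] := conj fn_neq0 f_lt_n.
Qed.

Lemma semigroup_of_unitary A n : subalgebra A ->
  semigroup_of A n <-> exists2 f, A f & unitary_at n f.
Proof.
move=> Aalg; have [_ AD _] := (subalgebraP A).1 Aalg; split.
  case=> [[f [Af f_neq0 fn]] | le_cn]; last first.
    by exists 0; [exact: subalgebra0 | exact: unitary_at0].
  have /trunc_ordP[fn_neq0 f_lt_n] := conj f_neq0 fn.
  exists ((tcoef f n)^-1 *: f).
    by rewrite -[_ *: _]addr0; apply: AD => //; exact: subalgebra0.
  move=> m; rewrite tcoefZ leq_eqVlt => /orP[/eqP -> _|lt_mn _].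
    by rewrite mulVf // eqxx.
  by rewrite (f_lt_n m) // mulr0 ltn_eqF.
move=> [f Af fn]; have [lt_nc|le_cn] := ltnP n c; last by right.
apply: (semigroup_of_order Af); first by rewrite fn // eqxx oner_eq0.
by move=> m lt_mn; rewrite fn ?ltn_eqF //; lia.
Qed.

(** Successive approximation: the difference of [f] and the current approximant
    from [B] has its order in the common semigroup, so [B] has an element that
    cancels the leading term.  Since [t^c = 0], [c] steps suffice. *)
Lemma subalgebra_eq_of_semigroup A B : subalgebra A -> subalgebra B -> B `<=` A ->
  semigroup_of A = semigroup_of B -> A = B.
Proof.
move=> Aalg Balg BA eAB; apply/seteqP; split=> // f Af.
have [_ BD _] := (subalgebraP B).1 Balg.
have approx n : exists2 g, B g & forall m, (m < n)%N -> tcoef (f - g) m = 0.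
  elim: n => [|n [g Bg fg]]; first by exists 0 => //; exact: subalgebra0.
  have [fgn|fgn_neq0] := eqVneq (tcoef (f - g) n) 0.
    exists g => // m; rewrite ltnS leq_eqVlt => /orP[/eqP -> //|]; exact: fg.
  have : semigroup_of A n.
    by apply: (semigroup_of_order _ fgn_neq0 fg); apply: subalgebraB => //; exact: BA.
  rewrite eAB => /(semigroup_of_unitary _ Balg)[h Bh hn].
  set a := tcoef (f - g) n; exists (a *: h + g); first exact: BD.
  have -> : f - (a *: h + g) = (f - g) + (- a) *: h.
    by rewrite opprD addrCA addrC scaleNr.
  move=> m lt_mn; rewrite [LHS]tcoefD tcoefZ.
  have [le_cm|lt_mc] := leqP c m; first by rewrite !tcoef_default // mulr0 addr0.
  rewrite hn //; have [->|ne_mn] := eqVneq m n; first by rewrite mulr1 subrr.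
  by rewrite fg ?mulr0 ?addr0 //; lia.
have [g Bg fg] := approx c.
suff -> : f = g by [].
apply/eqP; rewrite -subr_eq0; apply/eqP/tcoefP => m lt_mc.
by rewrite fg // tcoef0.
Qed.

(** * Subalgebras generated by two elements *)

(** Polynomials in [x] and [y] are the values of bivariate polynomials, whose
    evaluation is a ring morphism; its range is therefore a subalgebra, and
    expanding the evaluation gives the combination of monomials. *)
Lemma gen2_combination (x y f : trunc K c) :
  smallest (@subalgebra K c) [set x; y] f ->
  exists N (a : 'I_N * 'I_N -> K), f = \sum_ij a ij *: (x ^+ ij.1 * y ^+ ij.2).
Proof.
pose ev (p : {poly {poly K}}) := (map_poly (horner_alg x) p).[y].
have sub_ev : smallest (@subalgebra K c) [set x; y] `<=` range ev.
  apply: smallest_sub.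
    apply/subalgebraP; split; first by exists 1 => //; rewrite /ev rmorph1 hornerC.
      move=> a _ _ [p _ <-] [q _ <-]; exists (a%:P%:P * p + q) => //.
      by rewrite /ev rmorphD rmorphM hornerD hornerM /= map_polyC hornerC /=
         horner_algC -scalerAl mul1r.
    move=> _ _ [p _ <-] [q _ <-]; exists (p * q) => //.
    by rewrite /ev rmorphM hornerM.
  move=> _ [-> | ->]; last by exists 'X => //; rewrite /ev map_polyX hornerX.
  by exists ('X%:P) => //; rewrite /ev map_polyC hornerC /= horner_algX.
move=> /sub_ev[p _ <-].
(* A common bound for both degrees makes the index set rectangular. *)
pose N := maxn (size p) (\max_(i < size p) size (p`_i)%R).
exists N, (fun ij : 'I_N * 'I_N => p`_ij.2`_ij.1).
rewrite -(pair_big xpredT xpredT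
  (fun i j : 'I_N => p`_j`_i *: (x ^+ i * y ^+ j))) exchange_big /=.
rewrite /ev (@horner_coef_wide _ N); last first.
  by apply: leq_trans (size_poly _ _) _; exact: leq_maxl.
apply: eq_bigr => j _; rewrite coef_map /=.
rewrite /horner_alg /horner_morph (@horner_coef_wide _ N) ?mulr_suml; last first.
  apply: leq_trans (size_poly _ _) _.
  have [lt_j|le_j] := ltnP j (size p); last by rewrite nth_default ?size_poly0.
  apply: leq_trans (leq_maxr _ _).
  exact: (leq_bigmax (F := fun i : 'I_(size p) => size (p`_i)%R) (Ordinal lt_j)).
by apply: eq_bigr => i _; rewrite coef_map /= -scalerAl mul1r -scalerAl.
Qed.

(** The monomials [x^i * y^j] show that every element of the semigroup occurs as
    an order.  Conversely, below [c <= v0 * v1] their orders are pairwise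
    distinct, so combinations produce no new order. *)
Lemma semigroup_of_gen2 (v0 v1 : nat) (x y : trunc K c) :
  numerical_semigroup (smallest submonoid [set v0; v1]) ->
  is_conductor (smallest submonoid [set v0; v1]) c -> (0 < v0)%N ->
  unitary_at v0 x -> unitary_at v1 y ->
  semigroup_of (smallest (@subalgebra K c) [set x; y]) =
  smallest submonoid [set v0; v1].
Proof.
move=> numG condG v0_gt0 xv yv.
have cop := gen2_coprime numG; have le_c := conductor_le_mul v0_gt0 cop condG.
have mono i j : unitary_at (i * v0 + j * v1) (x ^+ i * y ^+ j).
  by apply: unitary_atM => //; apply: unitary_atX.
have Salg := smallest_subalgebra [set x; y].
have [_ _ SM] := (subalgebraP _).1 Salg.
apply/seteqP; split=> n; last first.
  move=> /gen2P[i [j ->]]; apply/(semigroup_of_unitary _ Salg).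
  exists (x ^+ i * y ^+ j) => //.
  by apply: SM; apply: (subalgebraX _ Salg); apply: sub_gen_smallest; [left|right].
case=> [[f [/gen2_combination[N [a f_def]] f_neq0 fn]] | /condG.1 //].
have /trunc_ordP[fn_neq0 f_lt_n] := conj f_neq0 fn.
have lt_nc : (n < c)%N.
  by rewrite ltnNge; apply: contra fn_neq0 => /tcoef_default ->.
have [|[i j] <-] := order_of_combination (fun ij : 'I_N * 'I_N => mono ij.1 ij.2) _ f_def
  lt_nc fn_neq0 f_lt_n; last by apply/gen2P; exists i, j.
move=> [i j] [k l] /= lt_ijc e.
have [|/val_inj -> /val_inj -> //] := gen2_unique v0_gt0 cop e.
exact: leq_trans le_c.
Qed.

(** * Normal forms *)

Section NormalForm.
Variables (G : set nat) (v : nat).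
Implicit Types a b : 'rV[K]_#|gaps_above G c v|.

Lemma tcoef_normal_form a m : (m < c)%N ->
  tcoef (normal_form a) m =
  (m == v)%:R + \sum_k a ord0 k * (m == enum_val k :> nat)%:R.
Proof.
move=> lt_mc; rewrite tcoef_in_qpoly // coefD coefXn coef_sum.
by congr (_ + _); apply: eq_bigr => k _; rewrite coefZ coefXn.
Qed.

Lemma gap_enum_val (k : 'I_#|gaps_above G c v|) :
  (v < enum_val k)%N /\ ~ G (enum_val k).
Proof.
have := enum_valP k; rewrite unfold_in /= => /andP[lt_v /negP Gk]; split=> // Gd.
by apply: Gk; exact: mem_set.
Qed.

Lemma tcoef_normal_form_gap a (k : 'I_#|gaps_above G c v|) :
  tcoef (normal_form a) (enum_val k) = a ord0 k.
Proof.
have [lt_v _] := gap_enum_val k.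
rewrite tcoef_normal_form // gtn_eqF // add0r (bigD1 k) //= eqxx mulr1 big1.
  by rewrite addr0.
move=> l ne_lk; rewrite val_eqE (inj_eq enum_val_inj) eq_sym (negPf ne_lk).
by rewrite mulr0.
Qed.

Lemma tcoef_normal_form_nongap a m :
  (m < c)%N -> (v < m)%N && (m \notin G) = false ->
  tcoef (normal_form a) m = (m == v)%:R.
Proof.
move=> lt_mc nongap; rewrite tcoef_normal_form // big1 ?addr0 // => k _.
case: eqP => [e|_]; last by rewrite mulr0.
by have := enum_valP k; rewrite unfold_in /= -e nongap.
Qed.

Lemma unitary_normal_form a : unitary_at v (normal_form a).
Proof.
by move=> m le_mv lt_mc; rewrite tcoef_normal_form_nongap // ltnNge le_mv.
Qed.

(** At the order of the difference the two coefficients would have to differ,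
    but they only differ at gaps, and the order is not a gap. *)
Lemma normal_form_inj A a b : subalgebra A -> semigroup_of A = G ->
  A (normal_form a) -> A (normal_form b) -> a = b.
Proof.
move=> Aalg AG Aa Ab; have Aab := subalgebraB Aalg Aa Ab.
have tcoefab m : tcoef (normal_form a - normal_form b) m =
    tcoef (normal_form a) m - tcoef (normal_form b) m.
  by rewrite -scaleN1r tcoefD tcoefZ mulN1r.
have [/subr0_eq e|ab_neq0] := eqVneq (normal_form a - normal_form b) 0.
  by apply/rowP => k; rewrite -!tcoef_normal_form_gap e.
have [n_neq0 lt_n] := (trunc_ordP _ _).1 (conj ab_neq0 erefl).
set n := trunc_ord _ in n_neq0 lt_n.
have Gn : G n by rewrite -AG; exact: (semigroup_of_order Aab).
have lt_nc : (n < c)%N.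
  by rewrite ltnNge; apply: contra n_neq0 => /tcoef_default ->.
move: n_neq0; rewrite tcoefab !tcoef_normal_form_nongap ?subrr ?eqxx //;
  by rewrite mem_set // andbF.
Qed.

(** Elements of [A] of order [n] remove, for increasing [n] in [G] above [v],
    the coefficients at non-gaps; each step leaves lower degrees alone. *)
Lemma normal_form_exists A : subalgebra A -> semigroup_of A = G -> G v ->
  exists a, A (normal_form a).
Proof.
move=> Aalg AG Gv; have [_ AD _] := (subalgebraP A).1 Aalg.
have reduce n : exists f, [/\ A f, unitary_at v f &
    forall m, (v < m < n)%N -> (m < c)%N -> G m -> tcoef f m = 0].
  elim: n => [|n [f [Af fv fn]]].
    have /(semigroup_of_unitary _ Aalg)[f Af fv] : semigroup_of A v by rewrite AG.
    by exists f; split=> // m; rewrite ltn0 andbF.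
  have [[lt_vn Gn]|skip] := pselect ((v < n)%N /\ G n); last first.
    exists f; split=> // m /andP[lt_vm]; rewrite ltnS leq_eqVlt => /orP[/eqP em|lt_mn].
      by rewrite em in lt_vm * => _ Gn; case: skip.
    by apply: fn; rewrite lt_vm.
  have /(semigroup_of_unitary _ Aalg)[h Ah hn] : semigroup_of A n by rewrite AG.
  exists ((- tcoef f n) *: h + f); split; first exact: AD.
    move=> m le_mv lt_mc; rewrite tcoefD tcoefZ hn ?(fv m) //; last by lia.
    by rewrite (ltn_eqF (leq_ltn_trans le_mv lt_vn)) mulr0 add0r.
  move=> m /andP[lt_vm lt_mn] lt_mc Gm; rewrite tcoefD tcoefZ hn //.
  have [->|ne_mn] := eqVneq m n; first by rewrite mulr1 addNr.
  by rewrite mulr0 add0r fn // lt_vm /=; lia.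
have [f [Af fv fc]] := reduce c.
pose a : 'rV[K]_#|gaps_above G c v| :=
  \row_(k < #|gaps_above G c v|) tcoef f (enum_val k).
exists a; suff -> : normal_form a = f by [].
apply: tcoefP => m lt_mc; case gap: ((v < m)%N && (m \notin G)).
  have gap' : Ordinal lt_mc \in gaps_above G c v by rewrite unfold_in.
  rewrite -[m]/(nat_of_ord (Ordinal lt_mc)) -(enum_rankK_in gap' gap').
  by rewrite tcoef_normal_form_gap mxE.
rewrite tcoef_normal_form_nongap //.
have [le_mv|lt_vm] := leqP m v; first by rewrite fv.
rewrite gtn_eqF // (fc m) ?lt_vm //.
by move: gap; rewrite lt_vm => /negbFE /set_mem.
Qed.

End NormalForm.
End Truncated.

(** * The bijection *)

Lemma ring_of_point_bij (K : fieldType) (G : set nat) (c v0 v1 : nat) :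
  numerical_semigroup G -> is_conductor G c -> (v0 < v1)%N ->
  minimal_generators G [set v0; v1] ->
  set_bij [set: 'rV[K]_(num_params G c v0 v1)]
          (@rings_with_semigroup K c G) (@ring_of_point K G c v0 v1).
Proof.
move=> numG condG lt01 minG; have G1 := gen2_not1 lt01 minG.
have GE := minG.1.
have c_gt0 : (0 < c)%N.
  by rewrite lt0n; apply/eqP => c0; apply: G1; apply: condG.1; rewrite c0.
have v0_gt0 : (0 < v0)%N.
  rewrite lt0n; apply/eqP => v00; apply: G1.
  move: numG; rewrite -GE => /gen2_coprime; rewrite v00 /coprime gcd0n => /eqP ->.
  by apply: sub_gen_smallest; right.
have [Gv0 Gv1] : G v0 /\ G v1.
  by rewrite -GE; split; apply: sub_gen_smallest; [left | right].
have sgE (a : 'rV[K]_(num_params G c v0 v1)) :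
    semigroup_of (ring_of_point a) = G.
  move: numG condG; rewrite -[in X in X -> _]GE -[in X in _ -> X -> _]GE => numG condG.
  rewrite -[RHS]GE; apply: semigroup_of_gen2 => //; exact: unitary_normal_form.
have ringA (a : 'rV[K]_(num_params G c v0 v1)) : subalgebra (ring_of_point a).
  exact: smallest_subalgebra.
split=> [a _|a b _ _ eab|A [Aalg AG]]; first by split.
  have aL : ring_of_point a (normal_form (lsubmx a)).
    by apply: sub_gen_smallest; left.
  have aR : ring_of_point a (normal_form (rsubmx a)).
    by apply: sub_gen_smallest; right.
  have bL : ring_of_point a (normal_form (lsubmx b)).
    by rewrite eab; apply: sub_gen_smallest; left.
  have bR : ring_of_point a (normal_form (rsubmx b)).
    by rewrite eab; apply: sub_gen_smallest; right.
  rewrite -[a]hsubmxK -[b]hsubmxK.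
  by rewrite (normal_form_inj c_gt0 (ringA a) (sgE a) aL bL)
             (normal_form_inj c_gt0 (ringA a) (sgE a) aR bR).
have [x Ax] := normal_form_exists c_gt0 Aalg AG Gv0.
have [y Ay] := normal_form_exists c_gt0 Aalg AG Gv1.
exists (row_mx x y) => //; apply/esym/(subalgebra_eq_of_semigroup c_gt0) => //.
  by apply: smallest_sub => // _ [-> | ->]; rewrite ?row_mxKl ?row_mxKr.
by rewrite sgE.
Qed.

Theorem theorem3p2 (R : realType) (G : set nat) (c v0 v1 : nat) :
  numerical_semigroup G ->
  is_conductor G c ->
  (v0 < v1)%N ->
  minimal_generators G [set v0; v1] ->
  set_bij [set: 'rV[R[i]]_(num_params G c v0 v1)]
          (@rings_with_semigroup R[i] c G)
          (@ring_of_point R[i] G c v0 v1).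
Proof. exact: ring_of_point_bij. Qed.
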